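(* For every integer $d \ge 1$ there exist a constant $C_2 > 1$ and an integer $k \ge 1$ such that, for every non-empty bounded set $\Sigma \subset M(d)$, $$\mathcal{R}(\Sigma) \le C_2 \max_{1 \le j \le k} \rho(\Sigma^j)^{1/j}.$$
   Context: $M(d)$ is the space of $d\times d$ complex matrices. For $A\in M(d)$, $\rho(A)$ is the spectral radius of $A$ (maximum absolute value of an eigenvalue). Given a norm $\|\cdot\|$ on $\mathbb{C}^d$, $M(d)$ carries the operator norm $\|A\| = \sup\{\|Av\| : \|v\|=1\}$. For a non-empty bounded set $\Sigma\subset M(d)$, $\|\Sigma\| = \sup_{A\in\Sigma}\|A\|$ and $\rho(\Sigma)=\sup_{A\in\Sigma}\rho(A)$; for an integer $n\ge 1$, $\Sigma^n$ is the set of all products $A_1\cdots A_n$ with all $A_i\in\Sigma$. The joint spectral radius of $\Sigma$ is $\mathcal{R}(\Sigma) = \lim_{n\to\infty}\|\Sigma^n\|^{1/n}$; this limit exists, equals $\inf_n \|\Sigma^n\|^{1/n}$, and does not depend on the chosen norm. *)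

(* Defs.v *)
(* The complex numbers are R[i] for an arbitrary R : realType. *)
From HB Require Import structures.
From mathcomp Require Import all_boot all_order all_algebra.
From mathcomp Require Import complex.
From mathcomp Require Import all_classical all_reals all_analysis.

Set Implicit Arguments.
Unset Strict Implicit.
Unset Printing Implicit Defensive.

Import Order.TTheory GRing.Theory Num.Theory.
Import numFieldNormedType.Exports.

Local Open Scope classical_set_scope.
Local Open Scope ring_scope.

(* The modulus of z as an element of R; the library's `|z| lives in R[i]. *)
Definition cmod (R : realType) (z : R[i]) : R := ComplexField.Normc.normc z.

Record is_norm (R : realType) (d : nat) (N : 'cV[R[i]]_d -> R) : Prop := IsNorm {
  is_norm_ge0 : forall v, 0 <= N v;
  is_norm_eq0 : forall v, N v = 0 -> v = 0;
  is_normZ : forall (a : R[i]) v, N (a *: v) = cmod a * N v;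
  is_norm_triangle : forall v w, N (v + w) <= N v + N w
}.

(* Real suprema below are taken with [sup], which is 0 on sets that are empty
   or unbounded. This default is never reached for d > 0, N a norm, and a
   nonempty set of matrices that is bounded for N. *)
Definition opnorm (R : realType) (d : nat) (N : 'cV[R[i]]_d -> R)
    (A : 'M[R[i]]_d) : R :=
  sup [set N (A *m v) | v in [set v | N v = 1]].

Definition mx_bounded (R : realType) (d : nat) (N : 'cV[R[i]]_d -> R)
    (S : set 'M[R[i]]_d) : Prop :=
  exists M : R, forall A, S A -> opnorm N A <= M.

Definition set_opnorm (R : realType) (d : nat) (N : 'cV[R[i]]_d -> R)
    (S : set 'M[R[i]]_d) : R :=
  sup [set opnorm N A | A in S].

(* The spectrum is finite, and nonempty for d > 0, so this sup is a maximum. *)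
Definition spectral_radius (R : realType) (d : nat) (A : 'M[R[i]]_d) : R :=
  sup [set cmod a | a in [set a | eigenvalue A a]].

Definition set_spectral_radius (R : realType) (d : nat)
    (S : set 'M[R[i]]_d) : R :=
  sup [set spectral_radius A | A in S].

Definition set_power (R : realType) (d : nat) (S : set 'M[R[i]]_d) (n : nat) :
    set 'M[R[i]]_d :=
  [set \prod_(i < n) A i | A in [set A : 'I_n -> 'M[R[i]]_d | forall i, S (A i)]].

(* The n = 0 term of this sequence is a junk value. *)
Definition joint_spectral_radius (R : realType) (d : nat)
    (N : 'cV[R[i]]_d -> R) (S : set 'M[R[i]]_d) : R :=
  lim ((fun n : nat => set_opnorm N (set_power S n) `^ n%:R^-1) @ \oo).

(* Main.v *)
Require Import Defs.
From HB Require Import structures.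
From mathcomp Require Import all_boot all_order all_algebra.
From mathcomp Require Import complex.
From mathcomp Require Import all_classical all_reals all_analysis.
From mathcomp Require Import ring lra zify.

Set Implicit Arguments.
Unset Strict Implicit.
Unset Printing Implicit Defensive.

Import Order.TTheory GRing.Theory Num.Theory.
Import numFieldNormedType.Exports.

Local Open Scope classical_set_scope.
Local Open Scope ring_scope.

(** Fix a norm and a bounded set [S] of joint spectral radius [L > 0]. The proof
    exhibits one product of elements of [S], of length bounded in terms of [d]
    alone, that nearly fixes a vector up to the expected growth factor; such a
    product has an eigenvalue of the right size, so the constant 2 suffices.

    For [T > L], the products of length [n] have norm at most [C * T ^+ n], and
    the supremum of [N (w *m v) / T ^+ n] over all products [w] of length [n]
    and all [n] is a new norm, for which [S] has operator norm at most [T]. If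
    [T] is close enough to [L], depending on a prescribed length [M], then some
    product of length [M] shrinks some vector by at most the factor 1/2
    compared with [T ^+ M]; otherwise products would grow more slowly than
    [L ^+ n] ([nearly_extremal_norm]). The [M + 1] points of the orbit of that
    vector, rescaled by powers of [T], all have norm between 1/2 and 1.

    Such an orbit must come back near itself: if [M] is large, two of its
    points are so close that the rescaled product [B] leading from one to the
    other satisfies [B u = u] up to a small error. Hence [\det (1 - B)] is
    smaller than [2 ^- d], and an eigenvalue of [B] has modulus more than 1/2
    ([recurrence_eigenvalue]). Undoing the rescaling, the product of length [n]
    has spectral radius at least [T ^+ n / 2 >= (T / 2) ^+ n].

    The new norm depends on [S], whereas [M] must not. This is achieved by
    working in a basis almost of Auerbach type ([almost_Auerbach_basis]), in
    which any norm is comparable to the maximum norm up to a factor depending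
    on [d] only. *)

(** * The real-valued modulus *)

Section Modulus.
Variable R : realType.
Implicit Types z w : R[i].

Lemma cmodE z : `|z| = (cmod z)%:C%C.
Proof. by rewrite normc_def; case: z. Qed.

Lemma cmod_ge0 z : 0 <= cmod z.
Proof. by rewrite -lecR -cmodE normr_ge0. Qed.

Lemma cmod0 : cmod (0 : R[i]) = 0.
Proof. by apply: complexI; rewrite -cmodE normr0. Qed.

Lemma cmod1 : cmod (1 : R[i]) = 1.
Proof. by apply: complexI; rewrite -cmodE normr1. Qed.

Lemma cmod_eq0 z : (cmod z == 0) = (z == 0).
Proof. by rewrite -(normr_eq0 z) cmodE; apply/eqP/eqP => [->|[]]. Qed.

Lemma cmodM z w : cmod (z * w) = cmod z * cmod w.
Proof. by apply: complexI; rewrite rmorphM /= -!cmodE normrM. Qed.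

Lemma cmodX z n : cmod (z ^+ n) = cmod z ^+ n.
Proof. by elim: n => [|n IHn]; rewrite ?expr0 ?cmod1 // !exprS cmodM IHn. Qed.

Lemma cmodV z : cmod z^-1 = (cmod z)^-1.
Proof. by apply: complexI; rewrite fmorphV /= -!cmodE normfV. Qed.

Lemma cmodN z : cmod (- z) = cmod z.
Proof. by apply: complexI; rewrite -!cmodE normrN. Qed.

Lemma cmodD z w : cmod (z + w) <= cmod z + cmod w.
Proof. by rewrite -lecR rmorphD /= -!cmodE ler_normD. Qed.

Lemma cmod_real (x : R) : cmod (x%:C)%C = `|x|.
Proof. by apply: complexI; rewrite -cmodE normc_def /= expr0n addr0 sqrtr_sqr. Qed.

Lemma cmodi : cmod ('i%C : R[i]) = 1.
Proof. by rewrite /cmod /= expr0n expr1n add0r sqrtr1. Qed.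

Lemma cmod_sum (I : Type) (r : seq I) (P : pred I) (F : I -> R[i]) :
  cmod (\sum_(i <- r | P i) F i) <= \sum_(i <- r | P i) cmod (F i).
Proof.
elim/big_rec2: _ => [|i y x _ le_xy]; first by rewrite cmod0.
by apply: le_trans (cmodD _ _) _; rewrite lerD2l.
Qed.

Lemma cmod_prod (I : Type) (r : seq I) (P : pred I) (F : I -> R[i]) :
  cmod (\prod_(i <- r | P i) F i) = \prod_(i <- r | P i) cmod (F i).
Proof. by apply: (big_morph _ cmodM cmod1). Qed.

Lemma cmod_parts (z : R[i]) (e : R) :
  `|complex.Re z| <= e -> `|complex.Im z| <= e -> cmod z <= e + e.
Proof.
move=> re im; have := cmodD (complex.Re z)%:C%C ('i%C * (complex.Im z)%:C%C).
rewrite -complexE cmodM cmod_real cmod_real.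
rewrite [cmod 'i%C](_ : _ = 1); last first.
  exact: cmodi.
rewrite mul1r => /le_trans; apply; exact: lerD.
Qed.

Lemma Re_le_cmod z : `|complex.Re z| <= cmod z.
Proof. by rewrite -lecR -cmodE normc_ge_Re. Qed.

Lemma Im_le_cmod z : `|complex.Im z| <= cmod z.
Proof.
have -> : complex.Im z = complex.Re (- ('i%C * z)).
  by case: z => a b /=; ring.
by apply: le_trans (Re_le_cmod _) _; rewrite cmodN cmodM cmodi mul1r.
Qed.

End Modulus.

(** * Norms on complex column vectors *)

Section NormBasics.
Variables (R : realType) (d : nat) (N : 'cV[R[i]]_d -> R).
Hypothesis normN : is_norm N.
Implicit Types v w : 'cV[R[i]]_d.

Lemma norm0 : N 0 = 0.
Proof. by rewrite -(scale0r (0 : 'cV_d)) (is_normZ normN) cmod0 mul0r. Qed.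

Lemma norm_gt0 v : v != 0 -> 0 < N v.
Proof.
move=> v0; rewrite lt_neqAle (is_norm_ge0 normN) andbT eq_sym.
by apply: contra_neq v0; exact: is_norm_eq0.
Qed.

Lemma normZ_real (x : R) v : N (x%:C%C *: v) = `|x| * N v.
Proof. by rewrite (is_normZ normN) cmod_real. Qed.

Lemma norm_opp v : N (- v) = N v.
Proof. by rewrite -scaleN1r (is_normZ normN) cmodN cmod1 mul1r. Qed.

Lemma norm_dist v w : `|N v - N w| <= N (v - w).
Proof.
rewrite ler_norml; have := is_norm_triangle normN (v - w) w.
have := is_norm_triangle normN (w - v) v.
by rewrite !subrK -(norm_opp (w - v)) opprB; lra.
Qed.

Lemma norm_sum (I : Type) (r : seq I) (F : I -> 'cV[R[i]]_d) :
  N (\sum_(i <- r) F i) <= \sum_(i <- r) N (F i).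
Proof.
elim/big_rec2: _ => [|i y x _ le_xy]; first by rewrite norm0.
by apply: le_trans (is_norm_triangle normN _ _) _; rewrite lerD2l.
Qed.

Lemma norm_le_coord v (e : R) : (forall i, cmod (v i 0) <= e) ->
  N v <= e * \sum_i N (delta_mx i 0).
Proof.
move=> ve; rewrite {1}(matrix_sum_delta v) exchange_big big_ord1 /=.
apply: le_trans (norm_sum _ _) _; rewrite mulr_sumr; apply: ler_sum => i _.
by rewrite (is_normZ normN) ler_wpM2r ?ve // (is_norm_ge0 normN).
Qed.

End NormBasics.

Section NormEquivalence.
Variables (R : realType) (d : nat) (N : 'cV[R[i]]_d -> R).
Hypothesis normN : is_norm N.

(** The real coordinates of a complex vector, real parts before imaginary
    parts: compactness and the extreme value theorem are used on real rows. *)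
Let cplx (x : 'rV[R]_(d + d)) : 'cV[R[i]]_d :=
  \col_i (x ord0 (lshift d i) +i* x ord0 (rshift d i))%C.

Let entry_le (x : 'rV[R]_(d + d)) j : `|x ord0 j| <= `|x|.
Proof.
rewrite [leRHS]/Num.Def.normr /= mx_normrE.
exact: (le_bigmax 0 (fun ij : 'I_1 * 'I_(d + d) => `|x ij.1 ij.2|) (ord0, j)).
Qed.

Let cplxB x y : cplx (x - y) = cplx x - cplx y.
Proof. by apply/colP => i; rewrite !mxE. Qed.

Let cplxZ (a : R) x : cplx (a *: x) = a%:C%C *: cplx x.
Proof. by apply/colP => i; rewrite !mxE; congr Complex; rewrite /=; ring. Qed.

Let norm_cplx x : N (cplx x) <= `|x| * (2 * \sum_i N (delta_mx i 0)).
Proof.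
rewrite mulrA; apply: norm_le_coord => // i; rewrite mxE mulr_natr mulr2n.
by apply: cmod_parts; exact: entry_le.
Qed.

Let cont_norm_cplx : continuous (N \o cplx).
Proof.
set K := 2 * \sum_i N (delta_mx i 0).
have K0 : 0 <= K.
  by apply: mulr_ge0 => //; apply: sumr_ge0 => i _; exact: is_norm_ge0.
move=> x; apply/(@cvgrPdist_le _ _ _ _ (nbhs_filter x)) => e e0.
near=> y.
have : `|x - y| <= e / (K + 1).
  near: y; apply/(@nbhs_normP _ _ x); exists (e / (K + 1)) => [|z /= /ltW //].
  by rewrite /= divr_gt0 // ltr_wpDl.
rewrite ler_pdivlMr ?ltr_wpDl // => xy.
apply: le_trans (norm_dist normN _ _) _; rewrite -cplxB.
apply: le_trans (norm_cplx _) _; apply: le_trans xy.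
by rewrite ler_wpM2l // lerDl.
Unshelve. all: by end_near. Qed.

(** A norm is continuous, so it attains a positive minimum on the compact unit
    sphere of the underlying real space; homogeneity does the rest. *)
Lemma coord_le_norm : exists2 c : R, 0 < c &
  forall (v : 'cV_d) i, cmod (v i 0) <= c * N v.
Proof.
have [d0|d_gt0] := posnP d.
  by exists 1 => // v i; have : (i < 0)%N by rewrite -[X in (_ < X)%N]d0.
pose A := [set x : 'rV[R]_(d + d) | `|x| = 1].
have A0 : A !=set0.
  have nz : const_mx 1 != 0 :> 'rV[R]_(d + d).
    apply/eqP => /rowP /(_ (lshift d (Ordinal d_gt0))).
    by rewrite !mxE => /eqP; rewrite oner_eq0.
  exists (`|const_mx 1 : 'rV[R]_(d + d)|^-1 *: const_mx 1).
  exact: normfZV.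
have cA : compact A.
  apply: bounded_closed_compact.
    by exists 1; split => // M M1 x /= ->; exact: ltW.
  rewrite (_ : A = Num.norm @^-1` [set 1]) //.
  apply: closed_comp => [x _|]; first exact: norm_continuous.
  exact: closed_eq.
have [x /set_mem Ax minx] := EVT_min_rV A0 cA (continuous_subspaceT cont_norm_cplx).
have m0 : 0 < N (cplx x).
  apply: norm_gt0 => //; apply/eqP => x0.
  have : x = 0.
    apply/rowP => j; move/colP: x0 => x0; rewrite mxE.
    by case: (split_ordP j) => i ->; have := x0 i; rewrite !mxE => -[].
  by move=> /eqP; rewrite -normr_eq0 [`|x|]Ax oner_eq0.
exists (2 / N (cplx x)) => [|v i]; first by rewrite divr_gt0.
pose y : 'rV[R]_(d + d) := row_mx (\row_j complex.Re (v j 0)) (\row_j complex.Im (v j 0)).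
have yv : cplx y = v.
  by apply/colP => j; rewrite mxE row_mxEl row_mxEr !mxE; case: (v j 0).
have vy : cmod (v i 0) <= 2 * `|y|.
  rewrite mulr_natl mulr2n; apply: cmod_parts.
    by have := entry_le y (lshift d i); rewrite row_mxEl mxE.
  by have := entry_le y (rshift d i); rewrite row_mxEr mxE.
apply: le_trans vy _; rewrite -mulrA ler_wpM2l // mulrC ler_pdivlMr // mulrC.
have [->|y0] := eqVneq y 0; first by rewrite normr0 mulr0 is_norm_ge0.
have /= := minx (`|y|^-1 *: y) (mem_set (normfZV y0)).
rewrite cplxZ yv normZ_real // ger0_norm ?invr_ge0 // mulrC.
by rewrite ler_pdivlMr ?normr_gt0.
Qed.

End NormEquivalence.

(** * The operator norm *)

Section OperatorNorm.
Variables (R : realType) (d : nat) (N : 'cV[R[i]]_d -> R).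
Hypotheses (normN : is_norm N) (d_gt0 : (0 < d)%N).
Implicit Types A B : 'M[R[i]]_d.

Lemma exists_unit_vector : exists v, N v = 1.
Proof.
have nz : const_mx 1 != 0 :> 'cV[R[i]]_d.
  apply/eqP => /colP /(_ (Ordinal d_gt0)).
  by rewrite !mxE => /eqP; rewrite oner_eq0.
exists ((N (const_mx 1))^-1%:C%C *: const_mx 1); rewrite normZ_real //.
have nv := norm_gt0 normN nz.
by rewrite ger0_norm ?invr_ge0 ?(ltW nv) // mulVf // gt_eqF.
Qed.

(** Boundedness of the set whose supremum is [opnorm N A]: without it the
    supremum would be the default value 0 and bound nothing. *)
Lemma mulmx_norm_bounded A : exists M, forall v, N (A *m v) <= M * N v.
Proof.
have [c c0 coordN] := coord_le_norm normN.
pose E : R := \sum_i N (delta_mx i 0).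
pose a : R := \sum_i \sum_j cmod (A i j).
have E0 : 0 <= E by apply: sumr_ge0 => i _; exact: is_norm_ge0.
exists (a * c * E) => v.
rewrite mulrAC; apply: norm_le_coord => // i; rewrite mxE -mulrA.
have ai : \sum_j cmod (A i j) <= a.
  rewrite /a [leRHS](bigD1 i) //= lerDl; apply: sumr_ge0 => k _.
  by apply: sumr_ge0 => j _; exact: cmod_ge0.
apply: le_trans (cmod_sum _ _ _) _.
apply: le_trans (ler_wpM2r _ ai); last by rewrite mulr_ge0 ?(ltW c0) ?is_norm_ge0.
rewrite mulr_suml; apply: ler_sum => j _.
by rewrite cmodM ler_wpM2l ?cmod_ge0.
Qed.

Lemma le_opnorm A v : N (A *m v) <= opnorm N A * N v.
Proof.
have [->|v0] := eqVneq v 0; first by rewrite mulmx0 norm0 // mulr0.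
have Nv := norm_gt0 normN v0.
have [M AM] := mulmx_norm_bounded A.
rewrite -ler_pdivrMr //; apply: ub_le_sup.
  by exists M => _ [w /= w1 <-]; rewrite -[M]mulr1 -w1.
exists ((N v)^-1%:C%C *: v) => /=.
  by rewrite normZ_real // ger0_norm ?invr_ge0 ?(ltW Nv) // mulVf // gt_eqF.
by rewrite -scalemxAr normZ_real // ger0_norm ?invr_ge0 ?(ltW Nv) // mulrC.
Qed.

Lemma opnorm_le A M : (forall v, N (A *m v) <= M * N v) -> opnorm N A <= M.
Proof.
move=> AM; apply: ge_sup.
  by have [v v1] := exists_unit_vector; exists (N (A *m v)), v.
by move=> _ [v /= v1 <-]; rewrite -[M]mulr1 -v1.
Qed.

Lemma opnorm_ge0 A : 0 <= opnorm N A.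
Proof.
have [v v1] := exists_unit_vector.
by have := le_opnorm A v; rewrite v1 mulr1; apply: le_trans; exact: is_norm_ge0.
Qed.

End OperatorNorm.

(** * Determinant estimates *)

Section DeterminantEstimates.
Variable R : realType.

Lemma cmod_det_le d (A : 'M[R[i]]_d) b : (forall i j, cmod (A i j) <= b) ->
  cmod (\det A) <= d`!%:R * b ^+ d.
Proof.
move=> Ab; apply: le_trans (cmod_sum _ _ _) _.
rewrite -perm.card_Sn mulr_natl -sumr_const.
rewrite [leRHS](eq_bigl xpredT) => [|s]; last by rewrite inE.
apply: ler_sum => s _; rewrite cmodM cmod_prod.
rewrite (_ : cmod _ = 1) ?mul1r; last first.
  by case: (perm.odd_perm s); rewrite ?expr1 ?expr0 ?cmodN cmod1.
rewrite -[X in _ ^+ X]card_ord -prodr_const; apply: ler_prod => i _.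
by rewrite cmod_ge0 Ab.
Qed.

(** The adjugate sends [A *m y] to [\det A *: y], so a bounded matrix that
    nearly kills a vector of size about 1 has a small determinant. *)
Lemma det_le_image d (A : 'M[R[i]]_d) (y : 'cV_d) b e :
  0 <= e -> (forall i j, cmod (A i j) <= b) -> (forall i, cmod ((A *m y) i 0) <= e) ->
  forall l, cmod (\det A) * cmod (y l 0) <= d%:R * (d.-1`!%:R * b ^+ d.-1 * e).
Proof.
move=> e0 Ab Aye l.
have -> : cmod (\det A) * cmod (y l 0) = cmod ((\adj A *m (A *m y)) l 0).
  by rewrite mulmxA mul_adj_mx mul_scalar_mx mxE cmodM.
rewrite mxE; apply: le_trans (cmod_sum _ _ _) _.
rewrite mulr_natl -[X in _ *+ X]card_ord -sumr_const.
apply: ler_sum => j _; rewrite cmodM ler_pM ?cmod_ge0 //.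
rewrite mxE cmodM (_ : cmod (_ ^+ _) = 1) ?mul1r; last first.
  by rewrite -signr_odd; case: odd; rewrite ?expr1 ?expr0 ?cmodN cmod1.
by apply: cmod_det_le => i k; rewrite !mxE.
Qed.

(** The determinant is the product of the factors [1 - a] over the
    eigenvalues [a], and each factor has modulus at least 1/2. *)
Lemma det_sub1_ge d (B : 'M[R[i]]_d) :
  (forall a, eigenvalue B a -> cmod a <= 1 / 2) ->
  (1 / 2) ^+ d <= cmod (\det (1%:M - B)).
Proof.
move=> small; have [r def_r] := closed_field_poly_normal (char_poly B).
rewrite (monicP (char_poly_monic B)) scale1r in def_r.
have size_r : size r = d.
  by have := size_char_poly B; rewrite def_r size_prod_XsubC => -[].
have -> : \det (1%:M - B) = (char_poly B).[1].
  rewrite -/(horner_eval 1 (char_poly B)) /char_poly -det_map_mx; congr (\det _).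
  apply/matrixP => i j; rewrite !mxE.
  by rewrite /horner_eval /= /horner_eval hornerD hornerN hornerMn hornerX hornerC.
rewrite def_r horner_prod cmod_prod -size_r.
rewrite -iter_mulr_1 -(count_predT r) -big_const_seq big_seq [leRHS]big_seq.
apply: ler_prod => a ar; rewrite divr_ge0 //= !hornerE.
have /small : eigenvalue B a by rewrite eigenvalue_root_char def_r root_prod_XsubC.
by have := cmodD (1 - a) a; rewrite subrK cmod1; lra.
Qed.

End DeterminantEstimates.

(** * Bases adapted to a norm *)

Section AlmostAuerbachBasis.
Variables (R : realType) (d : nat) (N : 'cV[R[i]]_d -> R).
Hypothesis normN : is_norm N.

(** In such coordinates the norm is comparable to the maximum norm with
    constants that depend on [d] only; this makes all later estimates uniform
    in the norm. Take vectors in the unit ball whose determinant is more than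
    half of the supremum: by Cramer's rule, each coordinate of a unit vector
    is a quotient of two determinants of vectors in the ball, hence at most 2. *)
Lemma almost_Auerbach_basis : exists P : 'M[R[i]]_d,
  [/\ P \in unitmx, forall j, N (col j P) <= 1 &
      forall v i, cmod ((invmx P *m v) i 0) <= 2 * N v].
Proof.
have [c c0 coordN] := coord_le_norm normN.
pose U := [set P : 'M[R[i]]_d | forall j, N (col j P) <= 1].
pose E := [set cmod (\det P) | P in U].
have ubE : has_ubound E.
  exists (d`!%:R * c ^+ d) => _ [P /= UP <-]; apply: cmod_det_le => i j.
  have := coordN (col j P) i; rewrite mxE => /le_trans; apply.
  by rewrite -[leRHS]mulr1 ler_wpM2l // ltW.
pose t : R := (1 + \sum_j N (delta_mx j 0))^-1.
have s0 : 0 <= \sum_j N (delta_mx j 0) by apply: sumr_ge0 => j _; exact: is_norm_ge0.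
have t0 : 0 < t by rewrite invr_gt0 ltr_pwDl.
(* A small multiple of the standard basis shows that the supremum is positive. *)
have Ut : U (t%:C%C)%:M.
  move=> j; rewrite (_ : col j _ = t%:C%C *: delta_mx j 0); last first.
    by apply/colP => i; rewrite !mxE mulr_natr eqxx andbT.
  rewrite normZ_real // gtr0_norm // mulrC ler_pdivrMr ?ltr_pwDl // mul1r.
  rewrite (bigD1 j) //= addrCA lerDl addr_ge0 //.
  by apply: sumr_ge0 => i _; exact: is_norm_ge0.
have Et : E (t ^+ d).
  exists (t%:C%C)%:M => //; rewrite det_scalar cmodX cmod_real.
  by rewrite gtr0_norm.
have supE : 0 < sup E by apply: lt_le_trans (ub_le_sup ubE Et); rewrite exprn_gt0.
have [_ [P UP <-] detP] : exists2 x, E x & sup E - sup E / 2 < x.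
  by apply: sup_adherent; [rewrite divr_gt0|split => //; exists (t ^+ d)].
have P0 : 0 < cmod (\det P) by apply: le_lt_trans detP; lra.
have unitP : P \in unitmx by rewrite unitmxE unitfE -cmod_eq0 gt_eqF.
exists P; split => // v i.
have [->|v0] := eqVneq v 0.
  by rewrite mulmx0 mxE cmod0 norm0 // mulr0.
have Nv := norm_gt0 normN v0.
pose u := (N v)^-1%:C%C *: v.
have Nu : N u = 1.
  by rewrite normZ_real // ger0_norm ?invr_ge0 ?(ltW Nv) // mulVf // gt_eqF.
suff : cmod ((invmx P *m u) i 0) <= 2.
  rewrite -scalemxAr mxE cmodM cmod_real ger0_norm ?invr_ge0 ?(ltW Nv) //.
  by rewrite mulrC ler_pdivrMr.
pose Q : 'M[R[i]]_d := \matrix_(k, j) if j == i then u k 0 else P k j.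
have UQ : U Q.
  move=> j; have [->|ji] := eqVneq j i.
    by rewrite (_ : col i Q = u) ?Nu //; apply/colP => k; rewrite !mxE eqxx.
  by rewrite (_ : col j Q = col j P) //; apply/colP => k; rewrite !mxE (negPf ji).
have -> : (invmx P *m u) i 0 = (\det P)^-1 * \det Q.
  rewrite /invmx unitP -scalemxAl mxE; congr (_ * _).
  rewrite mxE (expand_det_col _ i); apply: eq_bigr => k _.
  rewrite !mxE eqxx mulrC; congr (_ * _); rewrite /cofactor; congr (_ * \det _).
  by apply/matrixP => a b; rewrite !mxE [_ == i]eq_sym (negPf (neq_lift _ _)).
rewrite cmodM cmodV mulrC ler_pdivrMr //.
by have := ub_le_sup ubE (ex_intro2 _ _ Q UQ erefl : E (cmod (\det Q))); lra.
Qed.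

End AlmostAuerbachBasis.

(** * Recurrence of orbits produces an eigenvalue *)

Section Recurrence.
Variable R : realType.

(** Pigeonhole principle on a grid of mesh at most [e / 2] in the real and
    imaginary parts. *)
Lemma close_orbit_points d (e : R) : 0 < e ->
  exists2 M, (0 < M)%N & forall y : nat -> 'cV[R[i]]_d,
    (forall i l, (i <= M)%N -> cmod (y i l 0) <= 2) ->
    exists i j, [/\ (i < j)%N, (j <= M)%N & forall l, cmod (y i l 0 - y j l 0) <= e].
Proof.
move=> e0; pose K := (Num.truncn (2 / e)).+1.
have K_e : 1 / K%:R <= e / 2.
  rewrite ler_pdivrMr ?ltr0n // mulrC -ler_pdivrMr ?divr_gt0 //.
  by rewrite mul1r invf_div ltW // truncnS_gt.
(* The index of the grid cell that contains a coordinate in [-2, 2]. *)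
pose q (t : R) : nat := Num.truncn ((t + 2) * K%:R).
have q_lt t : `|t| <= 2 -> (q t < (4 * K).+1)%N.
  rewrite ler_norml => /andP[t1 t2]; rewrite truncn_lt_nat.
    by rewrite -[(4 * K).+1%:R]natr1 natrM ltr_pwDr // ler_wpM2r //; lra.
  by rewrite mulr_ge0 //; lra.
have q_close t s : `|t| <= 2 -> `|s| <= 2 -> q t = q s -> `|t - s| <= e / 2.
  rewrite (ler_norml t) (ler_norml s) => /andP[t1 t2] /andP[s1 s2] qts.
  apply: le_trans _ K_e.
  have K0 : 0 < K%:R :> R by rewrite ltr0n.
  have tK : 0 <= (t + 2) * K%:R by rewrite mulr_ge0 //; lra.
  have sK : 0 <= (s + 2) * K%:R by rewrite mulr_ge0 //; lra.
  have /andP[] := truncn_itv tK; have /andP[] := truncn_itv sK.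
  rewrite -/(q t) -/(q s) qts -natr1 => a1 a2 b1 b2.
  rewrite ler_pdivlMr // -[X in _ * X]gtr0_norm // -normrM ler_norml mulrBl.
  by move: a1 a2 b1 b2; rewrite !mulrDl; lra.
pose T := {ffun 'I_d -> 'I_(4 * K).+1 * 'I_(4 * K).+1}.
exists #|T| => [|y y2].
  by apply/card_gt0P; exists [ffun=> (ord0, ord0)].
pose f (i : 'I_#|T|.+1) : T :=
  [ffun l => (inord (q (complex.Re (y i l 0))), inord (q (complex.Im (y i l 0))))].
have /injectivePn[i [j ij fij]] : ~~ injectiveb f.
  by apply/negP => /injectiveP/leq_card; rewrite card_ord ltnn.
have close (a b : 'I_#|T|.+1) l : f a = f b -> cmod (y a l 0 - y b l 0) <= e.
  move=> /ffunP/(_ l); rewrite !ffunE => -[] /(congr1 val) /= reab /(congr1 val) /= imab.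
  have ya := y2 a l (ltn_ord a); have yb := y2 b l (ltn_ord b).
  have rea := le_trans (Re_le_cmod _) ya; have ima := le_trans (Im_le_cmod _) ya.
  have reb := le_trans (Re_le_cmod _) yb; have imb := le_trans (Im_le_cmod _) yb.
  rewrite !inordK ?q_lt // in reab imab.
  rewrite [e]splitr; apply: cmod_parts.
    by rewrite raddfB /=; apply: q_close.
  by rewrite raddfB /=; apply: q_close.
move: ij; rewrite neq_ltn => /orP[ij|ji].
  by exists i, j; split => // [|l]; [rewrite -ltnS | exact: close].
by exists j, i; split => // [|l]; [rewrite -ltnS | exact: close].
Qed.

(** An orbit of contractions that stays away from 0 has two close points
    [u i] and [u j] by pigeonhole. Then [B i j] nearly fixes [u i], so
    [\det (1%:M - B i j)] is tiny, which rules out that all eigenvalues of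
    [B i j] have modulus at most 1/2. Since the estimates are made in the
    coordinates of [almost_Auerbach_basis], [M] does not depend on [N]. *)
Lemma recurrence_eigenvalue d : (0 < d)%N -> exists2 M, (0 < M)%N &
  forall (N : 'cV[R[i]]_d -> R) (B : nat -> nat -> 'M[R[i]]_d) (u : nat -> 'cV_d),
    is_norm N ->
    (forall i j v, (i < j <= M)%N -> N (B i j *m v) <= N v) ->
    (forall i j, (i < j <= M)%N -> B i j *m u i = u j) ->
    (forall i, (i <= M)%N -> 1 / 2 <= N (u i) <= 1) ->
    exists i j a, [/\ (i < j <= M)%N, eigenvalue (B i j) a & 1 / 2 < cmod a].
Proof.
move=> d_gt0.
pose C : R := d%:R * (d.-1`!%:R * 4 ^+ d.-1).
have C0 : 0 < C by rewrite !mulr_gt0 ?exprn_gt0 ?ltr0n ?fact_gt0.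
(* With this tolerance the bound [2 * d%:R * C * e] on the determinant is half
   of the lower bound given by [det_sub1_ge]. *)
pose e : R := (1 / 2) ^+ d / (4 * d%:R * C).
have dC0 : 0 < 4 * d%:R * C by rewrite mulr_gt0 // mulr_gt0 ?ltr0n.
have half_d : 0 < (1 / 2 : R) ^+ d by rewrite exprn_gt0 // divr_gt0.
have e0 : 0 < e by rewrite divr_gt0.
have [M M0 closeM] := close_orbit_points d e0.
exists M => // N B u normN contr orbit u_bnd.
have [P [unitP colP1 coordP]] := almost_Auerbach_basis normN.
pose y i := invmx P *m u i.
have [|i [j [ij jM yij]]] := closeM y.
  move=> i l iM; apply: le_trans (coordP _ _) _; have /andP[_ u1] := u_bnd _ iM.
  by rewrite -[leRHS]mulr1 ler_wpM2l.
have ijM : (i < j <= M)%N by rewrite ij.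
apply: contrapT => noeig.
have small a : eigenvalue (B i j) a -> cmod a <= 1 / 2.
  by move=> eig_a; rewrite leNgt; apply/negP => a2; apply: noeig; exists i, j, a.
have := det_sub1_ge small.
pose D := invmx P *m (1%:M - B i j) *m P.
have -> : \det (1%:M - B i j) = \det D.
  by rewrite !det_mulmx det_inv mulrAC mulVr ?mul1r //.
have D4 k l : cmod (D k l) <= 4.
  have -> : D k l = (invmx P *m ((1%:M - B i j) *m col l P)) k 0.
    by rewrite colE !mulmxA -/D -(colE l D) [RHS]mxE.
  apply: le_trans (coordP _ _) _; rewrite mulmxBl mul1mx.
  have := is_norm_triangle normN (col l P) (- (B i j *m col l P)).
  rewrite norm_opp // => tri.
  have colB := le_trans (contr _ _ (col l P) ijM) (colP1 l).
  by apply: le_trans (ler_wpM2l _ (le_trans tri (lerD (colP1 l) colB))) _; lra.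
have Dy k : cmod ((D *m y i) k 0) <= e.
  have -> : D *m y i = y i - y j; last by rewrite mxE [(- y j) k 0]mxE.
  rewrite /D /y -!mulmxA mulKVmx // mulmxBl mul1mx orbit // mulmxBr.
  by [].
(* The basis vectors have norm at most 1 and [N (u i)] is at least 1/2, so some
   coordinate is not small. *)
have [l yl] : exists l, 1 / (2 * d%:R) <= cmod (y i l 0).
  apply: contrapT => nol.
  have : N (u i) < 1 / 2.
    have -> : u i = \sum_l y i l 0 *: col l P.
      rewrite -[u i](mulKVmx unitP) -/(y i).
      apply/colP => k; rewrite mxE summxE; apply: eq_bigr => l _.
      by rewrite !mxE mulrC.
    apply: le_lt_trans (norm_sum normN _ _) _.
    have -> : 1 / 2 = \sum_(l < d) (1 / (2 * d%:R)) :> R.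
      rewrite sumr_const card_ord -mulr_natr; field.
      by rewrite pnatr_eq0 -lt0n.
    apply: ltr_sum => [|l _].
      by apply/hasP; exists (Ordinal d_gt0); rewrite ?mem_index_enum.
    rewrite (is_normZ normN); apply: le_lt_trans (ler_wpM2l (cmod_ge0 _) (colP1 l)) _.
    by rewrite mulr1 ltNge; apply/negP => le_l; apply: nol; exists l.
  by have /andP[] := u_bnd i (leq_trans (ltnW ij) jM); rewrite leNgt => /negP.
have := det_le_image (ltW e0) D4 Dy l.
rewrite mulrA -/C => le_det ge_det.
have : cmod (\det D) * (1 / (2 * d%:R)) <= C * e.
  by apply: le_trans le_det; rewrite ler_wpM2l ?cmod_ge0.
have d0 : 0 < d%:R :> R by rewrite ltr0n.
have -> : C * e = (1 / 2) ^+ d / 2 * (1 / (2 * d%:R)).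
  by rewrite /e; field; rewrite !gt_eqF.
rewrite ler_pM2r ?divr_gt0 ?mulr_gt0 //; lra.
Qed.

End Recurrence.

(** * Products of matrices in a set *)

Section Products.
Variables (R : realType) (d : nat) (S : set 'M[R[i]]_d).
Implicit Types A B w : 'M[R[i]]_d.

Lemma set_power0 : set_power S 0 1.
Proof. by exists (fun=> 0) => [[]//|]; rewrite big_ord0. Qed.

Lemma set_powerM m n A B :
  set_power S m A -> set_power S n B -> set_power S (m + n) (A * B).
Proof.
move=> [F FS <-] [G GS <-].
exists (fun k => match fintype.split k with inl i => F i | inr j => G j end) => [k|].
  by case: (fintype.split k) => ?; [exact: FS | exact: GS].
rewrite big_split_ord /=; congr (_ * _); apply: eq_bigr => i _.
  by rewrite (unsplitK (inl i)).
by rewrite (unsplitK (inr i)).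
Qed.

Lemma set_powerD m n w : set_power S (m + n) w ->
  exists A B, [/\ set_power S m A, set_power S n B & w = A * B].
Proof.
move=> [F FS <-]; exists (\prod_(i < m) F (lshift n i)), (\prod_(i < n) F (rshift m i)).
by split; [exists (fun i => F (lshift n i)) => //|exists (fun i => F (rshift m i)) => //|
  rewrite big_split_ord].
Qed.

Lemma set_power_nonempty n : S !=set0 -> set_power S n !=set0.
Proof. by move=> [A SA]; exists (\prod_(i < n) A), (fun=> A). Qed.

Lemma set_power_nat n w : S !=set0 -> set_power S n w ->
  exists2 F : nat -> 'M[R[i]]_d, (forall k, S (F k)) & w = \prod_(0 <= k < n) F k.
Proof.
move=> [A SA] [G GS <-].
exists (fun k => if insub k is Some i then G i else A) => [k|].
  by case: insub => [i|].
by rewrite big_mkord; apply: eq_bigr => i _; rewrite valK.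
Qed.

Lemma set_power_segment (F : nat -> 'M[R[i]]_d) m n : (forall k, S (F k)) ->
  set_power S (n - m) (\prod_(m <= k < n) F k).
Proof.
move=> FS; rewrite -{2}[m]add0n big_addn big_mkord.
by exists (fun i : 'I_(n - m) => F (i + m)%N).
Qed.

End Products.

(** * Norms and spectral radii of the powers of a bounded set *)

Section Growth.
Variables (R : realType) (d : nat) (N : 'cV[R[i]]_d -> R) (S : set 'M[R[i]]_d).
Hypotheses (normN : is_norm N) (d_gt0 : (0 < d)%N).
Hypotheses (S0 : S !=set0) (bndS : mx_bounded N S).
Implicit Types A B w : 'M[R[i]]_d.

Lemma opnormM A B : opnorm N (A * B) <= opnorm N A * opnorm N B.
Proof.
apply: opnorm_le => // v; rewrite -mulmxE -mulmxA.
apply: le_trans (le_opnorm normN _ _) _.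
by rewrite -mulrA ler_wpM2l ?opnorm_ge0 // le_opnorm.
Qed.

Lemma opnorm1 : opnorm N 1 <= 1.
Proof. by apply: opnorm_le => // v; rewrite mul1mx mul1r. Qed.

Lemma set_power_bounded : exists2 M, 0 <= M &
  forall n w, set_power S n w -> opnorm N w <= M ^+ n.
Proof.
have [M SM] := bndS; have [A SA] := S0.
have M0 : 0 <= M by apply: le_trans (SM _ SA); exact: opnorm_ge0.
exists M => // n _ [F FS <-]; elim: n F FS => [|n IHn] F FS.
  by rewrite big_ord0; exact: opnorm1.
rewrite big_ord_recl exprS; apply: le_trans (opnormM _ _) _.
apply: ler_pM; rewrite ?opnorm_ge0 ?SM //; last exact: IHn.
Qed.

Lemma opnorm_le_set n w : set_power S n w -> opnorm N w <= set_opnorm N (set_power S n).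
Proof.
move=> Sw; have [M _ SM] := set_power_bounded; apply: ub_le_sup; last by exists w.
by exists (M ^+ n) => _ [A SA <-]; exact: SM.
Qed.

Lemma set_opnorm_le n K : (forall w, set_power S n w -> opnorm N w <= K) ->
  set_opnorm N (set_power S n) <= K.
Proof.
move=> SK; apply: ge_sup; last by move=> _ [A SA <-]; exact: SK.
by have [A SA] := set_power_nonempty n S0; exists (opnorm N A), A.
Qed.

Lemma set_opnorm_ge0 n : 0 <= set_opnorm N (set_power S n).
Proof.
have [A SA] := set_power_nonempty n S0.
by apply: le_trans (opnorm_le_set SA); exact: opnorm_ge0.
Qed.

(** [eigenvalue] provides a left eigenvector, whereas [opnorm] acts on columns;
    the determinant turns one into the other. *)
Lemma eigenvalue_le_opnorm A a : eigenvalue A a -> cmod a <= opnorm N A.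
Proof.
move=> /eigenvalueP[v vA v0].
have : \det (A - a%:M)^T == 0.
  rewrite det_tr; apply/det0P; exists v => //.
  by rewrite mulmxBr vA mul_mx_scalar subrr.
move=> /det0P[u u0 /(congr1 trmx)]; rewrite trmx_mul trmxK trmx0 mulmxBl.
move=> /subr0_eq; rewrite mul_scalar_mx => Au.
have := le_opnorm normN A u^T; rewrite Au (is_normZ normN) ler_pM2r //.
by apply: norm_gt0 => //; rewrite trmx_eq0.
Qed.

Lemma spectral_radius_le_opnorm A : spectral_radius A <= opnorm N A.
Proof.
rewrite /spectral_radius; set E := [set _ | _ in _].
have [->|/set0P E0] := eqVneq E set0; first by rewrite sup0 opnorm_ge0.
by apply: ge_sup => // _ [a /= Aa <-]; exact: eigenvalue_le_opnorm.
Qed.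

Lemma eigenvalue_le_set n w a : set_power S n w -> eigenvalue w a ->
  cmod a <= set_spectral_radius (set_power S n).
Proof.
move=> Sw wa; apply: (@le_trans _ _ (spectral_radius w)).
  apply: ub_le_sup; last by exists a.
  by exists (opnorm N w) => _ [b /= wb <-]; exact: eigenvalue_le_opnorm.
have [M _ SM] := set_power_bounded; apply: ub_le_sup; last by exists w.
exists (M ^+ n) => _ [A SA <-].
by apply: le_trans (spectral_radius_le_opnorm A) _; exact: SM.
Qed.

End Growth.

(** * Norms adapted to a set of matrices *)

Section ExtremalNorm.
Variables (R : realType) (d : nat) (N : 'cV[R[i]]_d -> R) (S : set 'M[R[i]]_d).
Variables (T C : R).
Hypotheses (normN : is_norm N) (T0 : 0 < T).
Hypothesis growth : forall n w v, set_power S n w -> N (w *m v) <= C * T ^+ n * N v.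

Let orbit_norms v : set R :=
  [set x | exists n w, set_power S n w /\ x = N (w *m v) / T ^+ n].

(** The Rota-Strang norm: as products of length [n] grow at most like [T ^+ n],
    it is finite, equivalent to [N], and the set has operator norm at most [T]
    for it. *)
Definition orbit_norm v : R := sup (orbit_norms v).

Let ub v : has_ubound (orbit_norms v).
Proof.
exists (C * N v) => _ [n [w [Sw ->]]].
by rewrite ler_pdivrMr ?exprn_gt0 // mulrAC growth.
Qed.

Let ne v : orbit_norms v !=set0.
Proof. by exists (N (1 *m v) / T ^+ 0), 0%N, 1; split=> //; exact: set_power0. Qed.

Lemma le_orbit_norm n w v : set_power S n w -> N (w *m v) / T ^+ n <= orbit_norm v.
Proof. by move=> Sw; apply: ub_le_sup => //; exists n, w. Qed.

Lemma orbit_norm_le v K : (forall n w, set_power S n w -> N (w *m v) <= K * T ^+ n) ->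
  orbit_norm v <= K.
Proof.
move=> vK; apply: ge_sup => // _ [n [w [Sw ->]]].
by rewrite ler_pdivrMr ?exprn_gt0 // vK.
Qed.

Lemma norm_le_orbit_norm v : N v <= orbit_norm v.
Proof. by have := le_orbit_norm v (set_power0 S); rewrite mul1mx expr0 divr1. Qed.

Lemma orbit_norm_le_norm v : orbit_norm v <= C * N v.
Proof. by apply: orbit_norm_le => n w Sw; rewrite mulrAC growth. Qed.

Lemma orbit_norm_contract n w v : set_power S n w ->
  orbit_norm (w *m v) <= T ^+ n * orbit_norm v.
Proof.
move=> Sw; apply: orbit_norm_le => m w' Sw'.
rewrite mulmxA mulrAC -exprD addnC mulrC -ler_pdivrMr ?exprn_gt0 //.
by apply: le_orbit_norm; exact: set_powerM.
Qed.

Lemma orbit_norm_is_norm : is_norm orbit_norm.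
Proof.
have ge0 v : 0 <= orbit_norm v.
  exact: le_trans (is_norm_ge0 normN v) (norm_le_orbit_norm v).
have leZ a v : orbit_norm (a *: v) <= cmod a * orbit_norm v.
  apply: orbit_norm_le => n w Sw; rewrite -scalemxAr (is_normZ normN) -mulrA.
  by rewrite ler_wpM2l ?cmod_ge0 // -ler_pdivrMr ?exprn_gt0 // le_orbit_norm.
split=> // [v v0|a v|v w].
- apply: (is_norm_eq0 normN); apply/eqP; rewrite eq_le is_norm_ge0 // andbT -v0.
  exact: norm_le_orbit_norm.
- apply/eqP; rewrite eq_le leZ /=.
  have [->|a0] := eqVneq a 0; first by rewrite cmod0 mul0r.
  have := leZ a^-1 (a *: v); rewrite scalerA mulVf // scale1r cmodV mulrC.
  by rewrite ler_pdivlMr ?lt_neqAle ?cmod_ge0 ?andbT 1?eq_sym ?cmod_eq0 // mulrC.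
- apply: orbit_norm_le => n x Sx; rewrite mulmxDr mulrDl.
  apply: le_trans (is_norm_triangle normN _ _) _.
  by apply: lerD; rewrite -ler_pdivrMr ?exprn_gt0 // le_orbit_norm.
Qed.

End ExtremalNorm.

(** * The growth rate and a nearly extremal norm *)

Section Roots.
Variable R : realType.

Lemma rootK (x : R) n : 0 <= x -> (0 < n)%N -> (x `^ n%:R^-1) ^+ n = x.
Proof.
move=> x0 n0; rewrite -powR_mulrn ?powR_ge0 // -powRrM mulVf ?powRr1 //.
by rewrite pnatr_eq0 -lt0n.
Qed.

Lemma le_root (t x : R) n : 0 <= t -> 0 <= x -> (0 < n)%N ->
  (t <= x `^ n%:R^-1) = (t ^+ n <= x).
Proof.
by move=> t0 x0 n0; rewrite -[in RHS](rootK x0 n0) ler_pXn2r // nnegrE ?powR_ge0.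
Qed.

Lemma root_lt (t x : R) n : 0 <= t -> 0 <= x -> (0 < n)%N ->
  (x `^ n%:R^-1 < t) = (x < t ^+ n).
Proof. by move=> t0 x0 n0; rewrite !ltNge le_root. Qed.

End Roots.

Section GrowthRate.
Variables (R : realType) (d : nat) (N : 'cV[R[i]]_d -> R) (S : set 'M[R[i]]_d).
Hypotheses (normN : is_norm N) (d_gt0 : (0 < d)%N).
Hypotheses (S0 : S !=set0) (bndS : mx_bounded N S).
Variable L : R.
Hypothesis cvgL :
  (fun n : nat => set_opnorm N (set_power S n) `^ n%:R^-1) @ \oo --> L.

Lemma growth_upper T : 0 < T -> L < T -> exists C, 0 <= C /\
  forall n w, set_power S n w -> opnorm N w <= C * T ^+ n.
Proof.
move=> T0 LT; have [M M0 SM] := set_power_bounded normN d_gt0 S0 bndS.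
have [n0 _ fT] := cvgr_lt L cvgL _ LT.
have sum0 m : 0 <= \sum_(k < m) (M / T) ^+ k.
  by apply: sumr_ge0 => k _; rewrite exprn_ge0 // divr_ge0 // ltW.
exists (1 + \sum_(k < n0.+1) (M / T) ^+ k); split=> [|n w Sw].
  by rewrite addr_ge0.
have Tn : 0 < T ^+ n by rewrite exprn_gt0.
have [n_le|n_gt] := leqP n n0.
  apply: le_trans (SM _ _ Sw) _; rewrite -ler_pdivrMr // -expr_div_n.
  rewrite (bigD1 (Ordinal (n_le : (n < n0.+1)%N))) //= addrCA lerDl addr_ge0 //.
  by apply: sumr_ge0 => k _; rewrite exprn_ge0 // divr_ge0 // ltW.
apply: le_trans (opnorm_le_set normN d_gt0 S0 bndS Sw) _.
have := fT n (ltnW n_gt); rewrite /= root_lt ?set_opnorm_ge0 ?(ltW T0) //; last first.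
  exact: leq_ltn_trans n_gt.
move=> /ltW/le_trans; apply; rewrite mulrDl mul1r lerDl.
by apply: mulr_ge0; [exact: sum0 | exact: ltW].
Qed.

Lemma growth_lower t : 0 <= t -> t < L -> exists n0, forall n, (n0 <= n)%N -> (0 < n)%N ->
  t ^+ n <= set_opnorm N (set_power S n).
Proof.
move=> t0 tL; have [n0 _ ft] := cvgr_gt L cvgL _ tL.
exists n0 => n n0n n_gt0; have := ft n n0n.
by move=> /ltW; rewrite /= le_root // set_opnorm_ge0.
Qed.

(** For the Rota-Strang norm with [T] slightly above [L], some product of
    length [M] has norm more than half of [T ^+ M]. Otherwise the products of
    length [n * M] have norm of order [(T ^+ M / 2) ^+ n], which grows strictly
    more slowly than [L ^+ (n * M)] as soon as [T ^+ M < 2 * L ^+ M]. *)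
Lemma nearly_extremal_norm M : (0 < M)%N -> 0 < L ->
  exists (T : R) (N' : 'cV[R[i]]_d -> R),
  [/\ L < T, is_norm N',
      forall n w v, set_power S n w -> N' (w *m v) <= T ^+ n * N' v &
      exists w v, set_power S M w /\ T ^+ M * N' v < 2 * N' (w *m v)].
Proof.
move=> M0 L0.
(* The growth rate is compared with [L * s] from above and [L / s] from below;
   the choice of [s] gives [(L * s) ^+ M / 2 = 3 / 4 * (L / s) ^+ M]. *)
pose s : R := (3 / 2) `^ (2 * M)%N%:R^-1.
have s2M : s ^+ M * s ^+ M = 3 / 2.
  by rewrite -exprD addnn -mul2n rootK // muln_gt0.
have s0 : 0 < s by rewrite powR_gt0.
have s1 : 1 < s.
  rewrite ltNge; apply/negP => s1.
  have : s ^+ M <= 1 by rewrite exprn_ile1 // ltW.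
  have : 0 <= s ^+ M by rewrite exprn_ge0 // ltW.
  by move: s2M; nra.
have T0 : 0 < L * s by rewrite mulr_gt0.
have LT : L < L * s by rewrite ltr_pMr.
have [C [C0 SC]] := growth_upper T0 LT.
have growth n w v : set_power S n w -> N (w *m v) <= C * (L * s) ^+ n * N v.
  move=> Sw; apply: le_trans (le_opnorm normN _ _) _.
  by rewrite ler_wpM2r ?is_norm_ge0 // SC.
pose N' := orbit_norm N S (L * s).
have N'contr := orbit_norm_contract T0 growth.
exists (L * s), N'; split=> //. exact: (orbit_norm_is_norm normN T0 growth).
apply: contrapT => none.
have half w v : set_power S M w -> N' (w *m v) <= (L * s) ^+ M / 2 * N' v.
  move=> Sw; rewrite leNgt; apply/negP => lt_w; apply: none; exists w, v.
  by split=> //; move: lt_w; rewrite -/N'; lra.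
pose tau := (L * s) ^+ M / 2.
have tau0 : 0 <= tau by rewrite divr_ge0 // exprn_ge0 // ltW.
have decay n w v : set_power S (n * M) w -> N' (w *m v) <= tau ^+ n * N' v.
  elim: n w v => [|n IHn] w v.
    by rewrite mul0n => /N'contr; apply.
  rewrite mulSn => /set_powerD[A [B [SA SB ->]]].
  rewrite -mulmxE -mulmxA exprS -mulrA; apply: le_trans (half _ _ SA) _.
  by rewrite ler_wpM2l // IHn.
have decayN n : set_opnorm N (set_power S (n * M)) <= C * tau ^+ n.
  apply: set_opnorm_le => // w Sw; apply: opnorm_le => // v.
  apply: le_trans (norm_le_orbit_norm T0 growth _) _.
  apply: le_trans (decay _ _ _ Sw) _; rewrite mulrAC mulrC ler_wpM2r ?exprn_ge0 //.
  exact: orbit_norm_le_norm.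
have ts : 0 <= L / s by rewrite divr_ge0 // ltW.
have tL : L / s < L by rewrite ltr_pdivrMr // ltr_pMr.
have [n0 lower] := growth_lower ts tL.
have tauE : tau = 3 / 4 * (L / s) ^+ M.
  rewrite /tau exprMn expr_div_n.
  have sM : s ^+ M != 0 by rewrite gt_eqF // exprn_gt0.
  have -> : 3 / 4 * (L ^+ M / s ^+ M) = L ^+ M * (3 / 2 / s ^+ M) / 2 by field.
  by rewrite -s2M mulfK.
have q1 : `|3 / 4 : R| < 1 by rewrite ger0_norm; lra.
have [n1 _ small] := cvgr_lt 0 (cvg_geometric C q1) _ ltr01.
pose n := maxn n1 n0.+1.
have n_gt0 : (0 < n)%N by rewrite leq_max orbT.
have := small n (leq_maxl _ _); rewrite /= ltNge => /negP; apply.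
have nM : (n <= n * M)%N by rewrite leq_pmulr.
have := lower (n * M)%N (leq_trans (leq_trans (leqnSn _) (leq_maxr _ _)) nM).
rewrite muln_gt0 n_gt0 M0 => /(_ isT) /le_trans/(_ (decayN n)).
have X0 : 0 < (L / s) ^+ M by rewrite exprn_gt0 // divr_gt0.
rewrite tauE mulnC exprM; move: X0; set X := _ ^+ M => X0.
by rewrite exprMn mulrA -[X in X <= _]mul1r ler_pM2r // exprn_gt0.
Qed.

End GrowthRate.

(** * The inequality *)

Theorem theorem2 (R : realType) (d : nat) (d_ge1 : (1 <= d)%N) :
  exists (C2 : R) (k : nat),
    [/\ 1 < C2, (1 <= k)%N &
      forall (N : 'cV[R[i]]_d -> R), is_norm N ->
      forall S : set 'M[R[i]]_d, S !=set0 -> mx_bounded N S ->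
        joint_spectral_radius N S <=
          C2 * \big[Num.max/0]_(1 <= j < k.+1)
                 (set_spectral_radius (set_power S j) `^ j%:R^-1)].
Proof.
have [M M0 recurM] := recurrence_eigenvalue R d_ge1.
exists 2, M; split=> [||N normN S S0 bndS]; [by rewrite ltr1n|by []|].
set rhs := \big[Num.max/0]_(_ <= _ < _) _.
have rhs0 : 0 <= rhs by rewrite /rhs; apply: bigmax_ge_id.
rewrite /joint_spectral_radius; set f := fun n : nat => _.
(* The limit of a divergent sequence is the default point, which is 0. *)
case: (pselect (cvg (f @ \oo))) => [cvgf|/dvgP ->]; last by rewrite mulr_ge0.
have [L0|L0] := leP (lim (f @ \oo)) 0; first by apply: le_trans L0 _; rewrite mulr_ge0.
have [T [N' [LT normN' contr [w [v [Sw wv]]]]]] :=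
  nearly_extremal_norm normN d_ge1 S0 bndS cvgf M0 L0.
apply: le_trans (ltW LT) _; rewrite mulrC -ler_pdivrMr //.
have T0 : 0 < T by apply: lt_trans LT.
have TX n : 0 < T ^+ n by rewrite exprn_gt0.
have [F FS wF] := set_power_nat S0 Sw.
have Nv : 0 < N' v.
  rewrite lt_neqAle is_norm_ge0 // andbT eq_sym; apply/eqP => /(is_norm_eq0 normN') v0.
  by move: wv; rewrite v0 mulmx0 norm0 // !mulr0 ltxx.
(* The leftmost factor of a product acts last, so the orbit of [v] is formed by
   the suffixes of [w], and [W i j] leads from its [i]-th to its [j]-th point. *)
pose W i j := \prod_(M - j <= k < M - i) F k.
have WS i j : (i <= j <= M)%N -> set_power S (j - i) (W i j).
  move=> /andP[ij jM]; rewrite (_ : (j - i)%N = (M - i - (M - j))%N); last by lia.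
  exact: set_power_segment.
pose B i j := (T ^- (j - i))%:C%C *: W i j.
pose u i := (T ^- i / N' v)%:C%C *: (W 0%N i *m v).
have BW i j x : B i j *m x = (T ^- (j - i))%:C%C *: (W i j *m x) by rewrite -scalemxAl.
have Bcontr i j x : (i < j <= M)%N -> N' (B i j *m x) <= N' x.
  move=> /andP[ij jM]; rewrite BW normZ_real // gtr0_norm ?invr_gt0 //.
  by rewrite mulrC ler_pdivrMr // mulrC; apply: contr; apply: WS; rewrite jM ltnW.
have orbit i j : (i < j <= M)%N -> B i j *m u i = u j.
  move=> /andP[ij jM]; rewrite BW /u -scalemxAr scalerA -rmorphM /= mulmxA mulmxE.
  have -> : W i j * W 0%N i = W 0%N j.
    by rewrite /W subn0 -big_cat_nat //; lia.
  by congr (_%:C%C *: _); rewrite mulrA -invfM -exprD subnK // ltnW.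
have NuM : 1 / 2 < N' (u M).
  rewrite /u normZ_real // gtr0_norm ?divr_gt0 ?invr_gt0 //.
  have -> : W 0%N M = w by rewrite /W subnn subn0 wF.
  rewrite [ltRHS]mulrC mulrA ltr_pdivlMr // ltr_pdivlMr //.
  by move: wv; rewrite mulrC; lra.
have u_bnd i : (i <= M)%N -> 1 / 2 <= N' (u i) <= 1.
  move=> iM; apply/andP; split.
    apply: (le_trans (ltW NuM)); have [->//|iM'] := eqVneq i M.
    have iltM : (i < M <= M)%N by rewrite leqnn ltn_neqAle iM' iM.
    by rewrite -(orbit _ _ iltM) Bcontr.
  rewrite /u normZ_real // gtr0_norm ?divr_gt0 ?invr_gt0 // mulrC mulrA.
  rewrite ler_pdivrMr // mul1r ler_pdivrMr // mulrC -[X in T ^+ X]subn0.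
  by apply: contr; apply: WS.
have [i [j [a [ijM Ba a2]]]] := recurM N' B u normN' Bcontr orbit u_bnd.
have /andP[ij jM] := ijM; have ji0 : (0 < j - i)%N by rewrite subn_gt0.
have Wa : eigenvalue (W i j) ((T ^+ (j - i))%:C%C * a).
  have /eigenvalueP[x xB x0] := Ba; apply/eigenvalueP; exists x => //.
  rewrite -scalerA -xB -scalemxAr scalerA -rmorphM /= divff ?scale1r //.
  by rewrite gt_eqF.
have WSij : set_power S (j - i) (W i j) by apply: WS; rewrite jM ltnW.
have := eigenvalue_le_set normN d_ge1 S0 bndS WSij Wa.
rewrite cmodM cmod_real gtr0_norm // => le_rho.
have rho_ge : (T / 2) ^+ (j - i) <= set_spectral_radius (set_power S (j - i)).
  apply: le_trans le_rho; rewrite expr_div_n ler_pM2l //.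
  apply: le_trans (ltW a2); rewrite mul1r lef_pV2 ?posrE ?exprn_gt0 //.
  by rewrite -[leLHS]expr1 ler_eXn2l // ltr1n.
apply: (bigmax_sup_seq _ (j - i)%N) => //.
  by rewrite mem_index_iota ji0 ltnS (leq_trans (leq_subr _ _)).
rewrite le_root //; last by apply: le_trans rho_ge; rewrite exprn_ge0 // divr_ge0 // ltW.
by rewrite divr_ge0 // ltW.
Qed.
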